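(* Let $H\leqslant G$ be finitely generated, recursively presented groups and suppose that $H$ has decidable membership problem in $G$. Then $\mathfrak{M}_{\mathtt{SFT}}(H)\subset\mathfrak{M}_{\mathtt{SFT}}(G)$ and $\mathfrak{M}_{\mathtt{SOF}}(H)\subset\mathfrak{M}_{\mathtt{SOF}}(G)$.
   Context: Alphabets are finite. For a group $G$ and alphabet $A$, $A^G=\{x\colon G\to A\}$ carries the prodiscrete topology and the shift action $(gx)(h)=x(g^{-1}h)$. A $G$-subshift is a closed $G$-invariant set $X\subset A^G$. For finite $F\subset G$ and a pattern $p\in A^F$ let $[p]=\{x\in A^G: x|_F=p\}$. $X$ is a subshift of finite type (SFT) if there is a finite set $\mathcal F$ of patterns with $X=\{x: gx\notin[p]\ \forall g\in G,\ p\in\mathcal F\}$. A subshift is sofic if it is the image of an SFT under a continuous $G$-equivariant map. Medvedev degrees: for $P,Q\subset\{0,1\}^{\mathbb N}$ write $P\le Q$ if there is a partial computable function $\Psi$ on $\{0,1\}^{\mathbb N}$ (a Turing functional) defined on all of $Q$ with $\Psi(Q)\subset P$. The Medvedev degree $m(P)$ is the class of $P$ under the equivalence $P\le Q\le P$. For a group $G$ with finite generating set $S$, free group $F(S)$ and canonical epimorphism $\rho\colon F(S)\to G$, the pullback of a subshift $X\subset A^G$ is $\widehat X=\{x\circ\rho: x\in X\}\subset A^{F(S)}$. Via a computable bijection $\mathbb N\to F(S)$ and a fixed-length binary coding of $A$, $\widehat X$ is identified with a subset of $\{0,1\}^{\mathbb N}$, and $m(X):=m(\widehat X)$ (independent of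 choices). $\mathfrak{M}_{\mathtt{SFT}}(G)$ and $\mathfrak{M}_{\mathtt{SOF}}(G)$ are the sets of degrees $m(X)$ for $X$ a nonempty $G$-SFT, respectively a nonempty sofic $G$-subshift. A finitely generated group is recursively presented if the set of words in a finite generating set representing the identity is recursively enumerable. $H$ has decidable membership problem in $G$ if, for a finite symmetric generating set $S$ of $G$, the set of words $w\in S^*$ representing an element of $H$ is decidable. *)

(* Defs.v *)
From HB Require Import structures.
From mathcomp Require Import all_boot finmap.
From mathcomp Require Import all_classical topology function_spaces.

Set Implicit Arguments.
Unset Strict Implicit.
Unset Printing Implicit Defensive.

Local Open Scope classical_set_scope.
Local Open Scope group_scope.
Local Open Scope nat_scope.

(** * Computability relative to an oracle *)

(** Kleene's mu-recursive schemes with an oracle. Programs are untyped with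
    respect to arity: superfluous arguments are ignored, and a program applied
    to too few arguments has no value. *)
Inductive program : Type :=
| Zero
| Succ
| Proj of nat
| Query
| Compose of program & seq program
| Primrec of program & program
| Minimize of program.

(** [eval o e v r]: with oracle [o], the program [e] halts on the argument list
    [v] with value [r]. The recursion (resp. search) variable of [Primrec]
    (resp. [Minimize]) is the first argument; in the case of [Minimize], [m]
    collects the (nonzero) values found before the first zero. *)
Inductive eval (o : nat -> nat) : program -> seq nat -> nat -> Prop :=
| eval_zero v : eval o Zero v 0
| eval_succ n v : eval o Succ (n :: v) n.+1
| eval_proj i v : i < size v -> eval o (Proj i) v (nth 0 v i)
| eval_query n v : eval o Query (n :: v) (o n)
| eval_compose f gs v ws r :
    size ws = size gs ->
    (forall i, i < size gs -> eval o (nth Zero gs i) v (nth 0 ws i)) ->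
    eval o f ws r -> eval o (Compose f gs) v r
| eval_primrec0 f g v r :
    eval o f v r -> eval o (Primrec f g) (0 :: v) r
| eval_primrecS f g n v s r :
    eval o (Primrec f g) (n :: v) s -> eval o g (n :: s :: v) r ->
    eval o (Primrec f g) (n.+1 :: v) r
| eval_minimize f v n (m : nat -> nat) :
    (forall i, i < n -> eval o f (i :: v) (m i).+1) ->
    eval o f (n :: v) 0 -> eval o (Minimize f) v n.

Definition computable (f : nat -> nat) : Prop :=
  exists e, forall n, eval (fun=> 0) e [:: n] (f n).

Definition decidable_set (D : set nat) : Prop :=
  exists chi : nat -> bool,
    computable (fun n => nat_of_bool (chi n)) /\ D = [set n | chi n].

Definition recursively_enumerable (D : set nat) : Prop :=
  D = set0 \/ exists f, computable f /\ D = range f.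

(** * Medvedev degrees *)

Definition cantor_point := nat -> bool.

(** The Turing functional given by [e], as a partial map: it sends [y] to [x]. *)
Definition functional (e : program) (y x : cantor_point) : Prop :=
  forall n, eval (fun i => nat_of_bool (y i)) e [:: n] (nat_of_bool (x n)).

Definition medvedev_le (P Q : set cantor_point) : Prop :=
  exists e, forall y, Q y -> exists2 x, P x & functional e y x.

Definition medvedev_degree (P : set cantor_point) : set (set cantor_point) :=
  [set Q | medvedev_le P Q /\ medvedev_le Q P].

(** * Words, free groups and generating families *)

(** [(i, false)] stands for the [i]-th generator, [(i, true)] for its
    inverse. *)
Definition word (k : nat) := seq ('I_k * bool).

Definition word_value (G : groupType) k (s : 'I_k -> G) (w : word k) : G :=
  \prod_(l <- w) (if l.2 then (s l.1)^-1 else s l.1)%g.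

Definition generates (G : groupType) k (s : 'I_k -> G) : Prop :=
  forall g, exists w : word k, word_value s w = g.

Definition word_code k (w : word k) : nat :=
  CodeSeq.code [seq (val l.1).*2 + nat_of_bool l.2 | l : 'I_k * bool <- w].

Definition reduced k (w : word k) : bool :=
  sorted (fun l1 l2 => (l1.1 != l2.1) || (l1.2 == l2.2)) w.

(** The free group on [k] letters, as the set of reduced words; only its
    underlying set and the canonical epimorphism [word_value s \o val] are
    needed. *)
Definition free_group (k : nat) := {w : word k | reduced w}.

(** A finite generating family [S] of [G] with a computable bijection from the
    natural numbers to F(S); the bijection forces [S] to be nonempty. *)
Record marking (G : groupType) := Marking {
  rank : nat;
  gens : 'I_rank -> G;
  gensP : generates gens;
  numbering : nat -> free_group rank;
  numbering_bij : bijective numbering;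
  numbering_computable : computable (fun n => word_code (val (numbering n)))
}.

Definition recursively_presented (G : groupType) : Prop :=
  exists k (s : 'I_k -> G), generates s /\
    recursively_enumerable [set word_code w | w in [set w | word_value s w = 1%g]].

(** The letters range over a symmetric generating family [t], and words are
    plain words over [t], without formal inverses. *)
Definition decidable_membership (G : groupType) (P : pred G) : Prop :=
  exists k (t : 'I_k -> G),
    [/\ generates t, forall i, exists j, t j = ((t i)^-1)%g &
        decidable_set [set CodeSeq.code [seq val i | i <- w] |
                        w in [set w : seq 'I_k | P (\prod_(i <- w) t i)%g]]].

(** * Subshifts *)

(** The full shift, with the prodiscrete topology. *)
Definition config (G : groupType) (A : finType) : topologicalType :=
  {ptws G -> discrete_topology A}.

Definition shift (G : groupType) (A : finType) (g : G) (x : config G A) :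
    config G A :=
  fun h => x (g^-1 * h)%g.

Definition subshift (G : groupType) (A : finType) (X : set (config G A)) :
    Prop :=
  closed X /\ forall g x, X x -> X (shift g x).

(** A pattern is a finite map, its support being its domain. *)
Definition cylinder (G : groupType) (A : finType) (p : {fmap G -> A}) :
    set (config G A) :=
  [set x | forall h : domf p, x (val h) = p h].

Definition sft (G : groupType) (A : finType) (X : set (config G A)) : Prop :=
  exists F : {fset {fmap G -> A}},
    X = [set x | forall g p, p \in F -> ~ cylinder p (shift g x)].

Definition sofic (G : groupType) (A : finType) (X : set (config G A)) : Prop :=
  subshift X /\
  exists (B : finType) (Y : set (config G B)) (phi : config G B -> config G A),
    [/\ sft Y, {within Y, continuous phi},
        forall g y, Y y -> phi (shift g y) = shift g (phi y) &
        phi @` Y = X].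

(** * Medvedev degrees of subshifts *)

Definition pullback (G : groupType) (A : finType) k (s : 'I_k -> G)
    (X : set (config G A)) : set (free_group k -> A) :=
  [set (fun w => x (word_value s (val w))) | x in X].

(** Symbols are coded in unary position: the code of [a : A] is the block of
    length [#|A|] whose only bit equal to 1 is at position [enum_rank a]. This
    has positive length, also when [A] is a singleton. *)
Definition stream (k : nat) (A : finType) (nu : nat -> free_group k)
    (x : free_group k -> A) : cantor_point :=
  fun n => n %% #|A| == enum_rank (x (nu (n %/ #|A|))).

Definition subshift_degree (G : groupType) (A : finType) (mu : marking G)
    (X : set (config G A)) : set (set cantor_point) :=
  medvedev_degree (stream (@numbering _ mu) @` pullback (@gens _ mu) X).

Definition degrees_sft (G : groupType) (mu : marking G) :
    set (set (set cantor_point)) :=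
  [set d | exists (A : finType) (X : set (config G A)),
    [/\ sft X, X !=set0 & d = subshift_degree mu X]].

Definition degrees_sofic (G : groupType) (mu : marking G) :
    set (set (set cantor_point)) :=
  [set d | exists (A : finType) (X : set (config G A)),
    [/\ sofic X, X !=set0 & d = subshift_degree mu X]].

(* Main.v *)
From mathcomp Require Import all_boot finmap.
From mathcomp Require Import all_classical topology function_spaces.
Require Import Defs.

Set Implicit Arguments.
Unset Strict Implicit.
Unset Printing Implicit Defensive.

Local Open Scope classical_set_scope.
Local Open Scope nat_scope.

(** An [H]-subshift [X] is replaced by its free extension, the configurations
    on [G] whose restriction to every left coset [g H], read through
    [h |-> g h], lies in [X]. It is defined by the same forbidden patterns, and
    a factor map applied coset by coset shows that it is sofic when [X] is.
    Restricting to [H] computes a point of [X] from a point of the extension.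
    Conversely a point [x] of [X] extends by [g |-> x (t(g)^-1 g)], where [t(g)]
    is the element of least index in the coset [g H], found by the decidable
    membership problem; a word over the generators of [H] with value
    [t(g)^-1 g] is then found by enumerating the relators of [G]. Both
    reductions merely reindex the given stream by a computable function. *)

(** * Computable functions and lists *)

(** This composes Turing functionals: each oracle call of [e] becomes a run of [q]. The call is
    trimmed by [Proj 0] because [q] is only known to work on one-element argument lists. *)
Fixpoint subst_query (q e : program) : program :=
  match e with
  | Query => Compose q [:: Proj 0]
  | Compose f gs => Compose (subst_query q f) (map (subst_query q) gs)
  | Primrec f g => Primrec (subst_query q f) (subst_query q g)
  | Minimize f => Minimize (subst_query q f)
  | _ => e
  end.

Lemma eval_subst_query (o o' : nat -> nat) q e v r :
  (forall n, eval o' q [:: n] (o n)) -> eval o e v r ->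
  eval o' (subst_query q e) v r.
Proof.
move=> qE; elim=> {e v r} /=.
- exact: eval_zero.
- exact: eval_succ.
- exact: eval_proj.
- move=> n v; apply: (@eval_compose _ _ _ _ [:: n]) => // -[] // _.
  exact: (@eval_proj _ 0 (n :: v)).
- move=> f gs v ws r sz _ gsE _ fE; apply: eval_compose fE; rewrite size_map //.
  by move=> i igs; rewrite (nth_map Zero) //; apply: gsE.
- by move=> f g v r _; apply: eval_primrec0.
- by move=> f g n v s r _ fE _ gE; apply: eval_primrecS fE gE.
- by move=> f v n m _ fE _ f0; apply: (eval_minimize fE).

Qed.

Lemma medvedev_le_trans P Q R :
  medvedev_le P Q -> medvedev_le Q R -> medvedev_le P R.
Proof.
move=> [e eE] [q qE]; exists (subst_query q e) => z /qE[y /eE[x Px ex] qy].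
by exists x => // n; apply: eval_subst_query (ex n).
Qed.

Lemma eq_medvedev_degree P Q :
  medvedev_le P Q -> medvedev_le Q P -> medvedev_degree P = medvedev_degree Q.
Proof.
move=> PQ QP; apply/seteqP; split=> R /= [le1 le2]; split;
  by [apply: medvedev_le_trans le1 | apply: medvedev_le_trans le2 _].
Qed.

Lemma medvedev_le_reindex (P Q : set cantor_point) f : computable f ->
  (forall y, Q y -> P (y \o f)) -> medvedev_le P Q.
Proof.
(* [e] computes [f] with the zero oracle; replacing its queries by [Zero] makes it compute [f] with
   any oracle. *)
move=> [e eE] QP; exists (Compose Query [:: subst_query Zero e]) => y Qy.
exists (y \o f); first exact: QP.
move=> n; apply: (@eval_compose _ _ _ _ [:: f n]) => //; last exact: eval_query.
case=> // _; apply: eval_subst_query (eE n) => m; exact: eval_zero.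
Qed.

(** An element [t] of [T] assigns to the variables the values [env t]. *)
Definition computable_in (T : Type) (env : T -> seq nat) (f : T -> nat) : Prop :=
  exists e, forall t, eval (fun=> 0) e (env t) (f t).

Definition computable2 (f : nat -> nat -> nat) : Prop :=
  computable_in (fun t : nat * nat => [:: t.1; t.2]) (fun t => f t.1 t.2).

Section Closure.
Variables (T : Type) (env : T -> seq nat).

Lemma computable_var i f :
  (forall t, i < size (env t) /\ f t = nth 0 (env t) i) -> computable_in env f.
Proof. by move=> fE; exists (Proj i) => t; have [? ->] := fE t; apply: eval_proj. Qed.

Lemma eq_computable f g : f =1 g -> computable_in env f -> computable_in env g.
Proof. by move=> fg [e eE]; exists e => t; rewrite -fg. Qed.

Lemma computable_app f a :
  computable f -> computable_in env a -> computable_in env (fun t => f (a t)).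
Proof.
move=> [e eE] [ea aE]; exists (Compose e [:: ea]) => t.
by apply: (@eval_compose _ _ _ _ [:: a t]) => // -[].
Qed.

Lemma computable_app2 f a b :
  computable2 f -> computable_in env a -> computable_in env b ->
  computable_in env (fun t => f (a t) (b t)).
Proof.
move=> [e eE] [ea aE] [eb bE]; exists (Compose e [:: ea; eb]) => t.
apply: (@eval_compose _ _ _ _ [:: a t; b t]) => [//|[|[|//]] //|].
exact: (eE (a t, b t)).
Qed.

Lemma computable_const c : computable_in env (fun=> c).
Proof.
elim: c => [|c IH]; first by exists Zero => t; apply: eval_zero.
apply: (computable_app (f := succn)) IH; exists Succ => n; exact: eval_succ.
Qed.

Lemma computable_rec a g :
  computable_in env a ->
  computable_in (fun p : nat * (nat * T) => [:: p.1, p.2.1 & env p.2.2])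
                (fun p => g p.2.2 p.1 p.2.1) ->
  computable_in (fun p : nat * T => p.1 :: env p.2)
                (fun p => nat_rect (fun=> nat) (a p.2) (g p.2) p.1).
Proof.
move=> [ea aE] [eg gE]; exists (Primrec ea eg) => -[n t] /=.
elim: n => [|n IH] /=; first exact: eval_primrec0.
exact: eval_primrecS IH (gE (n, (_, t))).
Qed.

Lemma computable_min g f :
  computable_in (fun p : nat * T => p.1 :: env p.2) (fun p => g p.2 p.1) ->
  (forall t, g t (f t) = 0) -> (forall t m, m < f t -> 0 < g t m) ->
  computable_in env f.
Proof.
move=> [e eE] g0 gpos; exists (Minimize e) => t.
apply: (@eval_minimize _ _ _ _ (fun i => (g t i).-1)).
  by move=> i lti; rewrite prednK ?gpos //; apply: (eE (i, t)).
by have := eE (f t, t); rewrite /= g0.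
Qed.

End Closure.

(** The least zero, chosen by [ex_minn], is the number that [Minimize] finds. Its minimality is kept
    because it later makes coset representatives canonical. *)
Lemma computable_search T (env : T -> seq nat) g :
  computable_in (fun p : nat * T => p.1 :: env p.2) (fun p => g p.2 p.1) ->
  (forall t, exists n, g t n = 0) ->
  exists f, [/\ computable_in env f, forall t, g t (f t) = 0 &
                forall t m, m < f t -> 0 < g t m].
Proof.
move=> gC g0.
have ex0 t : exists n, g t n == 0 by have [n] := g0 t; exists n; apply/eqP.
have fE t : g t (ex_minn (ex0 t)) = 0 by case: ex_minnP => n /eqP.
have fmin t m : m < ex_minn (ex0 t) -> 0 < g t m.
  by case: ex_minnP => n _ min; apply: contraTltn; rewrite leqn0 -leqNgt => /min.
by exists (fun t => ex_minn (ex0 t)); split=> //; apply: computable_min fmin.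
Qed.

Ltac variable :=
  first [ by apply: (@computable_var _ _ 0) | by apply: (@computable_var _ _ 1)
        | by apply: (@computable_var _ _ 2) | by apply: (@computable_var _ _ 3) ].

Lemma computable2_swap f : computable2 f -> computable2 (fun m n => f n m).
Proof. by move=> fC; apply: (computable_app2 fC); variable. Qed.

(** * Arithmetic functions *)

Lemma computable_succ : computable succn.
Proof. by exists Succ => n; apply: eval_succ. Qed.

Lemma computable_add : computable2 addn.
Proof.
apply: (@eq_computable _ _ (fun p => nat_rect (fun=> nat) p.2 (fun=> succn) p.1)).
  by case=> n m /=; elim: n => //= n ->.
apply: (@computable_rec _ (fun n => [:: n]) id (fun=> fun=> succn)); first by variable.
by apply: (computable_app computable_succ); variable.
Qed.

Lemma computable_pred : computable predn.
Proof.
(* [computable_rec] carries a parameter, so a dummy second argument is added and then filled with a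
   copy of the first. *)
suff pC : computable2 (fun n _ => n.-1).
  by apply: (computable_app2 pC (a := id) (b := id)); variable.
apply: (@eq_computable _ _ (fun p => nat_rect (fun=> nat) 0 (fun n _ => n) p.1)).
  by case=> -[|n].
apply: (@computable_rec _ (fun n => [:: n]) (fun=> 0) (fun=> fun n _ => n)).
  exact: computable_const.
by variable.
Qed.

Lemma computable_sub : computable2 subn.
Proof.
(* Recursion is on the first argument, so the subtrahend comes first; truncated subtraction then
   iterates [predn]. *)
apply: (@computable2_swap (fun n m => m - n)).
apply: (@eq_computable _ _ (fun p => nat_rect (fun=> nat) p.2 (fun=> predn) p.1)).
  by case=> n m /=; elim: n => [|n /= ->]; rewrite ?subn0 ?subnS.
apply: (@computable_rec _ (fun n => [:: n]) id (fun=> fun=> predn)); first by variable.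
by apply: (computable_app computable_pred); variable.
Qed.

Lemma computable_mul : computable2 muln.
Proof.
apply: (@eq_computable _ _ (fun p => nat_rect (fun=> nat) 0 (fun=> addn p.2) p.1)).
  by case=> n m /=; elim: n => //= n ->; rewrite mulSn.
apply: (@computable_rec _ (fun n => [:: n]) (fun=> 0) (fun m _ => addn m)).
  exact: computable_const.
by apply: (computable_app2 computable_add); variable.
Qed.

Lemma computable_exp2 : computable (expn 2).
Proof.
suff pC : computable2 (fun n _ => 2 ^ n).
  by apply: (computable_app2 pC (a := id) (b := id)); variable.
apply: (@eq_computable _ _ (fun p => nat_rect (fun=> nat) 1 (fun _ s => 2 * s) p.1)).
  by case=> n m /=; elim: n => //= n ->; rewrite expnS.
apply: (@computable_rec _ (fun n => [:: n]) (fun=> 1) (fun _ _ s => 2 * s)).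
  exact: computable_const.
by apply: (computable_app2 computable_mul); [exact: computable_const | variable].
Qed.

Definition ifz (a b z : nat) := if z is 0 then a else b.

Lemma computable_ifz T (env : T -> seq nat) a b z :
  computable_in env a -> computable_in env b -> computable_in env z ->
  computable_in env (fun t => ifz (a t) (b t) (z t)).
Proof.
move=> aC bC zC.
have oC : computable_in env (fun=> 1) by apply: computable_const.
(* By truncation [1 - z t] is the indicator of [z t = 0] and [1 - (1 - z t)] that of the opposite
   case. *)
pose f t := a t * (1 - z t) + b t * (1 - (1 - z t)).
apply: (@eq_computable _ _ f).
  move=> t; rewrite /f; case: (z t) => [|n] /=; rewrite ?subSS ?sub0n ?subn0.
    by rewrite muln1 muln0 addn0.
  by rewrite muln0 muln1.
have nC : computable_in env (fun t => 1 - z t).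
  exact: (computable_app2 computable_sub).
apply: (computable_app2 computable_add); apply: (computable_app2 computable_mul) => //.
exact: (computable_app2 computable_sub).
Qed.

(** The quotient is the least [q] with [m < q.+1 * d.+1]; the successor in the divisor guarantees
    that the search ends. *)
Lemma computable_div : computable2 (fun m d => m %/ d.+1).
Proof.
apply: (@computable_min _ _ (fun p q => p.1.+1 - q.+1 * p.2.+1)).
- apply: (computable_app2 computable_sub).
    by apply: (computable_app computable_succ); variable.
  apply: (computable_app2 computable_mul);
    by apply: (computable_app computable_succ); variable.
- by case=> m d /=; apply/eqP; rewrite subn_eq0 ltn_ceil.
- by case=> m d q /=; rewrite leq_divRL // subn_gt0.
Qed.

Lemma computable_divC c : computable (divn^~ c).
Proof.
case: c => [|c].
  by apply: (@eq_computable _ _ (fun=> 0)) (computable_const _ _) => n; rewrite divn0.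
apply: (computable_app2 computable_div (a := id)); first by variable.
exact: computable_const.
Qed.

Lemma computable_modC c : computable (modn^~ c).
Proof.
apply: (@eq_computable _ _ (fun n => n - n %/ c * c)).
  by move=> n; rewrite {1}(divn_eq n c) addKn.
apply: (computable_app2 computable_sub); first by variable.
apply: (computable_app2 computable_mul); last exact: computable_const.
exact: computable_divC.
Qed.

(** * Lists of numbers and their codes *)

Section ListCodes.
Import CodeSeq.

Definition head_code c := head 0 (decode c).
Definition tail_code c := code (behead (decode c)).
(** This is the recursion step of [CodeSeq.code], which sends the empty list to 0. The head of a
    nonempty list is thus the 2-adic valuation of its code. *)
Definition cons_code a c := 2 ^ a * c.*2.+1.

Lemma computable_cons : computable2 cons_code.
Proof.
apply: (computable_app2 computable_mul).
  by apply: (computable_app computable_exp2); variable.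
apply: (computable_app computable_succ).
apply: (@eq_computable _ _ (fun p => p.2 + p.2)) => [p|]; first by rewrite addnn.
by apply: (computable_app2 computable_add); variable.
Qed.

Lemma divn_cons_code a c : cons_code a c %/ 2 ^ a = c.*2.+1.
Proof. by rewrite mulKn ?expn_gt0. Qed.

Lemma computable_head : computable head_code.
Proof.
(* The search looks for the first [a] at which the quotient by [2 ^ a] is odd. On code 0 it stops at
   once, which agrees with the default head 0; [.-1.+1] gives the divisor the successor form that
   [computable_div] handles. *)
pose g c a := ifz 0 (1 - (c %/ ((2 ^ a).-1.+1)) %% 2) c.
apply: (@computable_min _ _ g).
- apply: computable_ifz; last by variable.
    exact: computable_const.
  apply: (computable_app2 computable_sub); first exact: computable_const.
  apply: (computable_app (computable_modC 2)).
  apply: (computable_app2 computable_div); first by variable.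
  apply: (computable_app computable_pred).
  by apply: (computable_app computable_exp2); variable.
- move=> c; rewrite /g prednK ?expn_gt0 // -{1 3}[c]decodeK /head_code.
  case: (decode c) => //= a s; rewrite -/(cons_code _ _) divn_cons_code.
  by rewrite modn2 /= odd_double subnn; case: cons_code.
- move=> c a; rewrite /g prednK ?expn_gt0 // -{2 3}[c]decodeK /head_code.
  case: (decode c) => //= b s ab; rewrite modn2 -(subnKC ab) expnD expnS.
  rewrite mulnAC -!mulnA mulnCA mulKn ?expn_gt0 // oddM /= subn0.
  by case E: (_ * _) => //; move/eqP: E; rewrite !muln_eq0 !expn_eq0.
Qed.

Lemma computable_tail : computable tail_code.
Proof.
apply: (@eq_computable _ _ (fun c => c %/ ((2 ^ (head_code c)).-1.+1) %/ 2)).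
  move=> c; rewrite prednK ?expn_gt0 // -{1}[c]decodeK /head_code /tail_code.
  case: (decode c) => //= a s; rewrite -/(cons_code _ _) divn_cons_code.
  by rewrite divn2 /= uphalf_double.
apply: (computable_app (computable_divC 2)).
apply: (computable_app2 computable_div); first by variable.
apply: (computable_app computable_pred); apply: (computable_app computable_exp2).
exact: computable_head.
Qed.

Lemma head_code_cons a s : head_code (code (a :: s)) = a.
Proof. by rewrite /head_code codeK. Qed.

Lemma tail_code_cons a s : tail_code (code (a :: s)) = code s.
Proof. by rewrite /tail_code codeK. Qed.

Lemma iter_tail_code i s : iter i tail_code (code s) = code (drop i s).
Proof.
elim: i => [|i /= ->]; first by rewrite drop0.
rewrite -add1n -drop_drop; case: (drop i s) => // a t.
by rewrite tail_code_cons /= drop0.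
Qed.

(** This lets the code of a list serve as the number of stages of a fold over it. *)
Lemma leq_size_code s : size s <= code s.
Proof.
elim: s => //= a s IH; apply: leq_trans (leq_pmull _ _); last by rewrite expn_gt0.
by rewrite ltnS (leq_trans IH) // -addnn leq_addr.
Qed.

Lemma computable_foldl F : computable2 F ->
  exists K, computable2 K /\
    forall s acc, K (code s) acc = foldl (fun b a => F a b) acc s.
Proof.
move=> FC.
have iterC : computable2 (fun i c => iter i tail_code c).
  apply: (@eq_computable _ _ (fun p => nat_rect (fun=> nat) p.2 (fun=> tail_code) p.1)).
    by case=> i c /=; elim: i => //= i ->.
  apply: (@computable_rec _ (fun n => [:: n]) id (fun=> fun=> tail_code)).
    by variable.
  by apply: (computable_app computable_tail); variable.
(* Stage [i] reads the head of the [i]-th iterated tail; once the list is exhausted this tail is 0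
   and the accumulator stays fixed. *)
pose g (t : nat * nat) i b :=
  ifz b (F (head_code (iter i tail_code t.1)) b) (iter i tail_code t.1).
pose K' i c acc := nat_rect (fun=> nat) acc (g (c, acc)) i.
exists (fun c acc => K' c c acc); split.
  have [e eE] : computable_in (fun p : nat * (nat * nat) => [:: p.1; p.2.1; p.2.2])
                      (fun p => K' p.1 p.2.1 p.2.2).
    apply: (@eq_computable _ _ (fun p => nat_rect (fun=> nat) p.2.2 (g p.2) p.1)).
      by case=> i [].
    apply: (@computable_rec _ (fun p : nat * nat => [:: p.1; p.2]) snd g).
      by variable.
    have itC : computable_in
        (fun p : nat * (nat * (nat * nat)) => [:: p.1, p.2.1 & [:: p.2.2.1; p.2.2.2]])
        (fun p => iter p.1 tail_code p.2.2.1).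
      by apply: (computable_app2 iterC); variable.
    apply: computable_ifz => //; first by variable.
    apply: (computable_app2 FC); last by variable.
    exact: (computable_app computable_head).
  exists (Compose e [:: Proj 0; Proj 0; Proj 1]) => -[c acc].
  apply: (@eval_compose _ _ _ _ [:: c; c; acc]) => //; last exact: (eE (c, (c, acc))).
  by move=> [|[|[|//]]] _; apply: eval_proj.
move=> s acc.
have KE i : K' i (code s) acc = foldl (fun b a => F a b) acc (take i s).
  elim: i => [|i IH]; first by rewrite take0.
  rewrite /K' /= -/(K' i (code s) acc) IH /g /= iter_tail_code.
  have [lt_is|le_si] := ltnP i (size s); last first.
    by rewrite drop_oversize // !take_oversize // (leq_trans le_si).
  rewrite (take_nth 0) // foldl_rcons (drop_nth 0) // head_code_cons.
  by case E: (code _) => [|//]; move/eqP: E; rewrite /= muln_eq0 expn_eq0.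
by rewrite KE take_oversize // leq_size_code.
Qed.

(** A finite table is computable whatever its entries [W] are: it is a cascade of comparisons with
    the letter codes, built by induction on the list of letters. *)
Lemma computable_prepend (L : eqType) (enc : L -> nat) (W : L -> seq nat) (ls : seq L) :
  injective enc ->
  exists F, computable2 F /\
    forall l s, l \in ls -> F (enc l) (code s) = code (W l ++ s).
Proof.
move=> encI; elim: ls => [|l0 ls [F [FC FE]]].
  by exists (fun _ _ => 0); split; first exact: computable_const.
have [P [PC PE]] : exists P, computable P /\ forall s, P (code s) = code (W l0 ++ s).
  elim: (W l0) => [|a w [P [PC PE]]]; first by exists id; split; first by variable.
  exists (fun c => cons_code a (P c)); split=> [|s]; last by rewrite PE.
  by apply: (computable_app2 computable_cons) => //; apply: computable_const.
(* The sum of the two truncated differences vanishes exactly when [a = enc l0]. *)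
exists (fun a c => ifz (P c) (F a c) ((a - enc l0) + (enc l0 - a))); split.
  apply: computable_ifz => //; first by apply: (computable_app PC); variable.
  have eC : computable_in (fun t : nat * nat => [:: t.1; t.2]) (fun=> enc l0).
    exact: computable_const.
  apply: (computable_app2 computable_add);
    by apply: (computable_app2 computable_sub) => //; variable.
move=> l s; rewrite inE; case: eqP => [-> _|/eqP neq /= lls].
  by rewrite !subnn /= PE.
rewrite FE //; case E: (_ + _) => [|//].
move/eqP: E; rewrite addn_eq0 !subn_eq0 -eqn_leq => /eqP /encI /eqP.
by rewrite (negPf neq).
Qed.

End ListCodes.

(** * Words and the word problem *)

Section WordProblem.
Variable G : groupType.

(** The alphabet and the values of its letters are left free, so that words with formal inverses,
    words over generators of a subgroup and plain words over a symmetric family are treated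
    alike. *)
Definition represents (L : finType) (enc : L -> nat) (v : L -> G) (c : nat) (g : G) :=
  exists2 w : seq L, CodeSeq.code [seq enc l | l <- w] = c & (\prod_(l <- w) v l)%g = g.

(* Prepending one after the other the words for the inverses of the letters of
   the first word reverses their order: this inverts the word. *)
Lemma represents_div (L M : finType) (encL : L -> nat) (encM : M -> nat)
    (vL : L -> G) (vM : M -> G) :
  injective encL -> injective encM ->
  (forall g, exists w : seq M, (\prod_(l <- w) vM l)%g = g) ->
  exists K, computable2 K /\
    forall c d g h, represents encL vL c g -> represents encM vM d h ->
      represents encM vM (K c d) (g^-1 * h)%g.
Proof.
move=> iL iM gen.
have /choice [W WE] l := gen ((vL l)^-1)%g.
have [F [FC FE]] := computable_prepend (fun l => [seq encM m | m <- W l]) (enum L) iL.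
have [K [KC KE]] := computable_foldl FC.
exists K; split=> // _ _ _ _ [u <- <-] [w <- <-]; rewrite {}KE.
elim: u w => [|l u IH] w /=.
  by exists w; rewrite // big_nil invg1 mul1g.
rewrite FE ?mem_enum // -map_cat; have [w' w'E w'v] := IH (W l ++ w).
by exists w' => //; rewrite w'v big_cat big_cons WE /= invgM mulgA.
Qed.

Lemma represents1 (L : finType) (enc : L -> nat) (v : L -> G) : represents enc v 0 1%g.
Proof. by exists [::]; rewrite ?big_nil. Qed.

(** Two left divisions give a product: the first turns [g] into [g^-1] over the second alphabet,
    starting from the empty word coded by 0; the second undoes the inversion in front of [h]. *)
Lemma represents_mul (L M : finType) (encL : L -> nat) (encM : M -> nat)
    (vL : L -> G) (vM : M -> G) :
  injective encL -> injective encM ->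
  (forall g, exists w : seq M, (\prod_(l <- w) vM l)%g = g) ->
  exists K, computable2 K /\
    forall c d g h, represents encL vL c g -> represents encM vM d h ->
      represents encM vM (K c d) (g * h)%g.
Proof.
move=> iL iM gen.
have [I [IC IE]] := represents_div vL iL iM gen.
have [J [JC JE]] := represents_div vM iM iM gen.
exists (fun c d => J (I c 0) d); split=> [|c d g h cg dh].
  apply: (computable_app2 JC); last by variable.
  by apply: (computable_app2 IC); [variable | exact: computable_const].
have := JE _ _ _ _ (IE _ _ _ _ cg (represents1 encM vM)) dh.
by rewrite mulg1 invgK.
Qed.

Definition computable_family (x : nat -> G) :=
  exists (L : finType) (enc : L -> nat) (v : L -> G) (c : nat -> nat),
    [/\ injective enc, computable c & forall n, represents enc v (c n) (x n)].

Lemma represents_uniq (L : finType) (enc : L -> nat) (v : L -> G) c g h :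
  injective enc -> represents enc v c g -> represents enc v c h -> g = h.
Proof.
move=> encI [w <- <-] [w' + <-] => /(can_inj CodeSeq.codeK).
by move=> /(inj_map encI) ->.
Qed.

(** Together with [letter_code], this makes [word_value] and [word_code] an instance of
    [represents]. *)
Definition letter_value (K : groupType) k (s : 'I_k -> K) (l : 'I_k * bool) : K :=
  if l.2 then ((s l.1)^-1)%g else s l.1.

Definition letter_code k (l : 'I_k * bool) : nat := (val l.1).*2 + nat_of_bool l.2.

Lemma letter_code_inj k : injective (@letter_code k).
Proof.
move=> [i b] [j c]; rewrite /letter_code /= => E.
have bc : b = c.
  by have := congr1 odd E; rewrite !oddD !odd_double; case: (b); case: (c).
by move: E; rewrite bc => /addIn /double_inj /val_inj ->.
Qed.

(** The equation says that a word computed from [n] and [l] is a relator. Relators are enumerable,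
    so a search over pairs of a candidate [l] and an index in the enumeration ends, a solution being
    known to exist. *)
Lemma word_problem_search (x y z : nat -> G) (a : nat -> nat) :
  recursively_presented G ->
  computable_family x -> computable_family y -> computable_family z ->
  computable a -> (forall n, exists l, (x (a n) * y l)%g = z n) ->
  exists f, computable f /\ forall n, (x (a n) * y (f n))%g = z n.
Proof.
move=> [k [s [sgen re]]] [X [eX [vX [cX [iX cXC cXE]]]]].
move=> [Y [eY [vY [cY [iY cYC cYE]]]]] [Z [eZ [vZ [cZ [iZ cZC cZE]]]]] aC sol.
have iS := @letter_code_inj k.
pose S := represents (@letter_code k) (letter_value s).
have relE c g : S c g -> (g = 1%g) <->
    [set word_code w | w in [set w | word_value s w = 1%g]]%classic c.
  move=> cg; split=> [g1|[w w1 wc]].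
    by move: cg; rewrite g1 => -[w wc w1]; exists w.
  apply: (represents_uniq iS cg); exists w => //; exact: w1.
have {re} [E [EC EE]] : exists E, computable E /\
    [set word_code w | w in [set w | word_value s w = 1%g]]%classic = range E.
  (* The empty word, coded by 0, is a relator, so the set of relators is not empty. *)
  case: re => // /seteqP[/(_ 0) /= rel0 _]; exfalso; apply: rel0.
  by exists [::]; rewrite // /word_value /= big_nil.
have [D [DC DE]] := represents_div vZ iZ iS sgen.
have [M [MC ME]] := represents_mul vX iX iS sgen.
have [N [NC NE]] := represents_mul vY iY iS sgen.
(* The three words are rewritten over the generators of the presentation, from right to left,
   starting from the empty word. *)
pose code n l := D (cZ n) (M (cX (a n)) (N (cY l) 0)).
have codeE n l : S (code n l) ((z n)^-1 * (x (a n) * y l))%g.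
  rewrite -[y l]mulg1; apply: DE (cZE n) _; apply: ME (cXE _) _.
  exact: NE (cYE _) (represents1 _ _).
have codeC : computable2 code.
  apply: (computable_app2 DC); first by apply: (computable_app cZC); variable.
  apply: (computable_app2 MC).
    by apply: (computable_app cXC); apply: (computable_app aC); variable.
  apply: (computable_app2 NC); last exact: computable_const.
  by apply: (computable_app cYC); variable.
(* [r] codes the list of a candidate [l] and the index of a relator. *)
pose u n r := code n (head_code r).
pose e (n r : nat) := E (head_code (tail_code r)).
have uC : computable_in (fun p : nat * nat => [:: p.1; p.2]) (fun p => u p.2 p.1).
  apply: (computable_app2 codeC); first by variable.
  by apply: (computable_app computable_head); variable.
have eC : computable_in (fun p : nat * nat => [:: p.1; p.2]) (fun p => e p.2 p.1).
  apply: (computable_app EC); apply: (computable_app computable_head).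
  by apply: (computable_app computable_tail); variable.
have [||r [rC r0 _]] := @computable_search _ (fun n => [:: n])
  (fun n r => (u n r - e n r) + (e n r - u n r)).
- by apply: (computable_app2 computable_add); apply: (computable_app2 computable_sub).
- move=> n; have [l ln] := sol n.
  have : range E (code n l).
    by rewrite -EE -(relE _ _ (codeE n l)) ln mulVg.
  case=> i _ Ei; exists (CodeSeq.code [:: l; i]).
  by rewrite /u /e tail_code_cons !head_code_cons Ei subnn.
exists (head_code \o r); split; first exact: (computable_app computable_head).
move=> n; have /eqP := r0 n; rewrite addn_eq0 !subn_eq0 -eqn_leq => /eqP ue.
suff /mulg1_eq : ((z n)^-1 * (x (a n) * y (head_code (r n))))%g = 1%g.
  by rewrite invgK => <-.
by rewrite (relE _ _ (codeE _ _)) EE -/(u n (r n)) ue; eexists.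
Qed.

(** The quotient is rewritten as a word over the family [t] of the membership problem and handed to
    its decision procedure; the answer depends only on the value of the word. *)
Lemma decidable_coset (P : pred G) (x z : nat -> G) :
  decidable_membership P -> computable_family x -> computable_family z ->
  exists chi : nat -> nat -> bool,
    computable2 (fun m n => nat_of_bool (chi m n)) /\
    forall m n, chi m n = P ((x m)^-1 * z n)%g.
Proof.
move=> [k [t [tgen tsym [chi [chiC chiE]]]]] [X [eX [vX [cX [iX cXC cXE]]]]].
move=> [Z [eZ [vZ [cZ [iZ cZC cZE]]]]].
(* As [t] is symmetric, each formal inverse can be replaced by a letter, so plain words reach every
   element. *)
have gen g : exists w : seq 'I_k, (\prod_(i <- w) t i)%g = g.
  have [w <-] := tgen g; elim: w => [|[i b] w [u uE]].
    by exists [::]; rewrite /word_value !big_nil.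
  rewrite /word_value big_cons -/(word_value _ _) -uE; case: b => /=.
    by have [j <-] := tsym i; exists (j :: u); rewrite big_cons.
  by exists (i :: u); rewrite big_cons.
have iT := @ord_inj k.
have [D [DC DE]] := represents_div vX iX iT gen.
have [M [MC ME]] := represents_mul vZ iZ iT gen.
exists (fun m n => chi (D (cX m) (M (cZ n) 0))); split.
  apply: (computable_app chiC).
  apply: (computable_app2 DC); first by apply: (computable_app cXC); variable.
  apply: (computable_app2 MC); last exact: computable_const.
  by apply: (computable_app cZC); variable.
move=> m n; set c := D _ _.
have cE : represents (@nat_of_ord k) t c ((x m)^-1 * z n)%g.
  by rewrite -[z n]mulg1; apply: DE (cXE m) (ME _ _ _ _ (cZE n) (represents1 _ _)).
have chiP : chi c <-> [set n | chi n]%classic c by [].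
apply/idP/idP; rewrite chiP -chiE.
  move=> [w Pw wc]; rewrite -(represents_uniq iT _ cE (g := (\prod_(i <- w) t i)%g)) //.
  by exists w.
by case: cE => w wc <- Pw; exists w.
Qed.

(** Needed because a marking numbers reduced words only. A letter put before a reduced word either
    leaves it reduced or cancels against its first letter. *)
Lemma exists_reduced k (s : 'I_k -> G) (w : word k) :
  exists2 u, reduced u & word_value s u = word_value s w.
Proof.
elim: w => [|[i b] w [u ured uE]]; first by exists [::].
rewrite /word_value big_cons -/(word_value s w) -uE /=.
case: u ured {uE} => [_|[j c] u /= red].
  by exists [:: (i, b)] => //; rewrite /word_value big_cons.
have [/andP[/eqP ij bc]|ok] := boolP ((i == j) && (b != c)); last first.
  exists [:: (i, b), (j, c) & u] => /=; last by rewrite /word_value big_cons.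
  by rewrite red andbT /=; move: ok; rewrite negb_and negbK.
exists u; first exact: path_sorted red.
rewrite /word_value big_cons /= mulgA ij.
by case: (b) (c) bc => [] [] //= _; rewrite ?mulVg ?mulgV mul1g.
Qed.

End WordProblem.

Definition marking_value (G : groupType) (mu : marking G) (n : nat) : G :=
  word_value (@gens _ mu) (val (@numbering _ mu n)).

Lemma marking_value_surj (G : groupType) (mu : marking G) g :
  exists n, marking_value mu n = g.
Proof.
have [w <-] := @gensP _ mu g; have [u ured <-] := exists_reduced (@gens _ mu) w.
have [f _ fK] := @numbering_bij _ mu.
by exists (f (Sub u ured)); rewrite /marking_value fK SubK.
Qed.

(** The morphism [f] serves to read words over the generators of a subgroup in the whole group, by
    mapping the generators. *)
Lemma marking_value_computable (G K : groupType) (mu : marking G)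
    (f : UMagmaMorphism.type G K) :
  computable_family (f \o marking_value mu).
Proof.
exists _, (@letter_code (rank mu)), (f \o letter_value (@gens _ mu)),
  (fun n => word_code (val (@numbering _ mu n))); split.
- exact: letter_code_inj.
- exact: (@numbering_computable _ mu).
- move=> n; exists (val (@numbering _ mu n)) => //.
  rewrite /marking_value /word_value /=.
  by rewrite (big_morph f gmulfM gmulf1).
Qed.

(** * Free extensions of subshifts *)

(** This is the universal property of the prodiscrete topology. *)
Lemma config_continuous (T : topologicalType) (K : groupType) (A : finType)
    (f : T -> config K A) :
  (forall k, continuous (fun t => f t k : discrete_topology A)) -> continuous f.
Proof.
move=> fC x; apply/cvg_sup => k.
apply: (@continuous_comp_initial _ T _ (fun y : config K A => y k) f _ x).
exact: fC.
Qed.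

Lemma config_eval_continuous (K : groupType) (A : finType) (k : K) :
  continuous (fun x : config K A => x k : discrete_topology A).
Proof. exact: (@proj_continuous K (fun=> discrete_topology A) k). Qed.

Section FreeExtension.
Variables (G : groupType) (P : pred G) (H : subGroupType P).

Definition coset_restriction (A : finType) (g : G) (y : config G A) : config H A :=
  fun h => y (g * val h)%g.

(** Ranging over all [g] avoids choosing representatives: two elements of one coset give
    restrictions that are shifts of each other. *)
Definition free_extension (A : finType) (X : set (config H A)) : set (config G A) :=
  [set y | forall g, X (coset_restriction g y)].

Lemma coset_restriction_shift A (g k : G) (y : config G A) :
  coset_restriction g (shift k y) = coset_restriction (k^-1 * g)%g y.
Proof. by apply/funext => h; rewrite /coset_restriction /shift mulgA. Qed.

Lemma shift_coset_restriction A (g : G) (h : H) (y : config G A) :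
  shift h (coset_restriction g y) = coset_restriction (g * (val h)^-1)%g y.
Proof.
by apply/funext => k; rewrite /coset_restriction /shift gmulfM gmulfV mulgA.
Qed.

Lemma cylinder_extension (A : finType) (p : {fmap H -> A}) :
  exists q : {fmap G -> A}, forall y, cylinder q y <-> cylinder p (y \o val).
Proof.
pose D := [fset val h | h in domf p]%fset.
have /choice [f fE] (g : D) : exists h : domf p, val (val h) = val g.
  by case: g => g /= /imfsetP[h hp ->]; exists [` hp]%fset.
exists [fmap g : D => p (f g)] => y; split=> yp h.
  have hD : val (val h) \in D by apply/imfsetP; exists (val h) => //; apply: valP.
  have := yp [` hD]%fset; rewrite ffunE /= => ->; congr (p _).
  by apply/val_inj/val_inj; rewrite fE.
by rewrite ffunE -yp /= fE.
Qed.

(** The pattern [p] occurs in the restriction at [g] shifted by [h] exactly when its push-forward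
    occurs in [y] shifted by [(g * (val h)^-1)^-1]. Taking [h = 1] reaches every shift of [y]. *)
Lemma sft_free_extension (A : finType) (X : set (config H A)) :
  sft X -> sft (free_extension X).
Proof.
move=> [F ->]; have /choice [e eE] := @cylinder_extension A.
exists [fset e p | p in F]%fset; apply/seteqP; split=> y yX g.
  move=> q /imfsetP[p pF ->] /eE; apply: (_ : ~ _).
  have := yX (g^-1)%g 1%g p pF.
  by rewrite shift_coset_restriction gmulf1 invg1 mulg1.
move=> h p pF; rewrite shift_coset_restriction => py.
apply: (yX (g * (val h)^-1)^-1%g (e p)); first by apply/imfsetP; exists p.
apply/eE; congr (cylinder p _): py; apply/funext => k.
by rewrite /shift /= invgK.
Qed.

Lemma mem_mulr g (h : H) : P (g * val h)%g = P g.
Proof.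
have sub k (l : H) : P k -> P (k * val l)%g.
  by move=> Pk; rewrite -(SubK H Pk) -gmulfM; apply: valP.
apply/idP/idP => [/(sub _ h^-1%g)|]; last exact: sub.
by rewrite gmulfV mulgK.
Qed.

(** A choice of left coset representatives, kept as a function on [G] so that both [choose] and a
    computable search can supply it. *)
Definition coset_transversal (t : G -> G) :=
  forall g, P ((t g)^-1 * g)%g /\ forall h : H, t (g * val h)%g = t g.

Lemma exists_coset_transversal : exists t, coset_transversal t.
Proof.
have P1 : P 1%g by rewrite -(gmulf1 (s := val : H -> G)); apply: valP.
pose Q (g k : G) := P (k^-1 * g)%g.
have Qg g : Q g g by rewrite /Q mulVg.
exists (fun g => choose (Q g) g) => g; split=> [|h]; first exact: (chooseP (Qg g)).
have QE : Q (g * val h)%g =1 Q g by move=> k; rewrite /Q mulgA mem_mulr.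
(* [choose] depends only on the predicate, not on the witness it starts from, hence is constant on a
   coset. *)
by rewrite (eq_choose QE); apply: choose_id => //; rewrite -QE.
Qed.

Section Gluing.
Variables (t : G -> G) (tE : coset_transversal t).

Definition coset_glue (A : finType) (x : G -> config H A) : config G A :=
  fun g => x (t g) (Sub ((t g)^-1 * g)%g (tE g).1).

(** The glued configuration copies [x (t g)] on the coset with origin at [t g]; reading from
    [g = t g * h] moves the origin by [h], hence the shift. *)
Lemma coset_restriction_coset_glue A (x : G -> config H A) g :
  exists2 h : H, (t g * val h)%g = g &
    coset_restriction g (coset_glue x) = shift h^-1%g (x (t g)).
Proof.
exists (Sub ((t g)^-1 * g)%g (tE g).1); first by rewrite SubK mulgA mulgV mul1g.
apply/funext => h; rewrite /coset_restriction /coset_glue /shift invgK.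
have tgh := (tE g).2 h; apply: (f_equal2 x tgh).
by apply: val_inj; rewrite gmulfM /= !SubK tgh mulgA.
Qed.

Lemma free_extension_coset_glue A (X : set (config H A)) x :
  (forall h y, X y -> X (shift h y)) -> (forall g, X (x g)) ->
  free_extension X (coset_glue x).
Proof.
by move=> XS Xx g; have [h _ ->] := coset_restriction_coset_glue x g; apply: XS.
Qed.

End Gluing.

Lemma coset_restriction_continuous A g : continuous (@coset_restriction A g).
Proof.
apply: config_continuous => h.
exact: (@config_eval_continuous G A (g * val h)%g).
Qed.

Lemma subshift_free_extension A (X : set (config H A)) :
  subshift X -> subshift (free_extension X).
Proof.
move=> [Xcl XS]; split; last by move=> k y Xy g; rewrite coset_restriction_shift.
rewrite (_ : free_extension X = \bigcap_(g in setT) (coset_restriction g @^-1` X)).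
  apply: closed_bigI => g _; apply: closed_comp Xcl => y _.
  exact: coset_restriction_continuous.
by apply/seteqP; split=> [y Xy g _|y Xy g]; [exact: Xy | exact: (Xy g I)].
Qed.

Lemma sft_shift (K : groupType) A (X : set (config K A)) h x :
  sft X -> X x -> X (shift h x).
Proof.
move=> [F ->] Xx k p pF /= px; apply: (Xx (k * h)%g p pF).
by congr (cylinder p _): px; apply/funext => g; rewrite /shift invgM mulgA.
Qed.

Lemma sofic_free_extension A (X : set (config H A)) :
  sofic X -> sofic (free_extension X).
Proof.
move=> [Xsub [B [Y [phi [Ysft phiC phiS phiX]]]]].
split; first exact: subshift_free_extension.
(* Each [g] is taken as the origin of its own coset and [phi] is read at the identity; by
   equivariance this is [phi] on every coset, which is [psiE]. *)
pose psi (y : config G B) : config G A := fun g => phi (coset_restriction g y) 1%g.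
have psiE g y : free_extension Y y ->
    coset_restriction g (psi y) = phi (coset_restriction g y).
  move=> Yy; apply/funext => h; rewrite /coset_restriction /psi.
  have -> : coset_restriction (g * val h)%g y = shift h^-1%g (coset_restriction g y).
    by rewrite shift_coset_restriction gmulfV invgK.
  by rewrite phiS ?Yy // /shift invgK mulg1.
exists B, (free_extension Y), psi; split.
- exact: sft_free_extension.
- apply: config_continuous => g.
  (* [phi] is continuous only within [Y], so restriction is first made a continuous map between the
     two subspaces. *)
  have YX : set_fun (free_extension Y) Y (@coset_restriction B g) by move=> y; apply.
  have resC : {within free_extension Y, continuous (mkfun YX)}.
    exact/continuous_subspaceT/coset_restriction_continuous.
  have /= fC := subspaceT_continuous (f := mkfun_fun YX) resC.
  move=> y; apply: (@continuous_comp _ _ _ (mkfun YX : subspace _ -> subspace Y)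
                      (fun x => phi x 1%g : discrete_topology A)); first exact: fC.
  apply: (@continuous_comp _ _ _ (from_subspace Y phi)
                      (fun x => x 1%g : discrete_topology A)); first exact: phiC.
  exact: config_eval_continuous.
- by move=> k y _; apply/funext => g; rewrite /psi coset_restriction_shift.
- apply/seteqP; split=> [_ [y Yy <-] g|x Xx].
    by rewrite psiE // -phiX; exists (coset_restriction g y).
  have [t tE] := exists_coset_transversal.
  (* Preimages under [phi] are chosen independently for all [g]; gluing keeps those at the
     representatives. *)
  have /choice [y yE] g : exists y, Y y /\ phi y = coset_restriction g x.
    by have := Xx g; rewrite -phiX => -[y]; exists y.
  exists (coset_glue tE y).
    by apply: free_extension_coset_glue => [h z|g]; [exact: sft_shift | case: (yE g)].
  apply/funext => g; rewrite /psi.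
  have [h th ->] := coset_restriction_coset_glue tE y g.
  have [Yy yx] := yE (t g); rewrite phiS // yx.
  by rewrite /shift /coset_restriction invgK mulg1 th.
Qed.

End FreeExtension.

(** * Medvedev degrees *)

Lemma medvedev_le_stream (A : finType) k l (nu : nat -> free_group k)
    (nu' : nat -> free_group l) (X : set (free_group k -> A))
    (Y : set (free_group l -> A)) (f : nat -> nat) :
  computable f ->
  (forall y, Y y -> exists2 x, X x & forall n, x (nu n) = y (nu' (f n))) ->
  medvedev_le (stream nu @` X) (stream nu' @` Y).
Proof.
(* A position is a block number and an offset inside the block of one symbol; only the block number
   is moved by [f]. *)
move=> fC YX; pose g n := f (n %/ #|A|) * #|A| + n %% #|A|.
apply: (@medvedev_le_reindex _ _ g).
  apply: (computable_app2 computable_add); last exact: computable_modC.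
  apply: (computable_app2 computable_mul); last exact: computable_const.
  exact: (computable_app fC (computable_divC _)).
move=> _ [y Yy <-]; have [x Xx xE] := YX y Yy; exists x => //.
have A0 : 0 < #|A| by apply/card_gt0P; exists (y (nu' 0)).
apply/funext => n; rewrite /stream /g /= modnMDl modn_mod divnMDl //.
by rewrite (divn_small (ltn_pmod _ A0)) addn0 xE.
Qed.

Section Degrees.
Variables (G : groupType) (P : pred G) (H : subGroupType P).
Variables (muG : marking G) (muH : marking H).
Hypotheses (Grp : recursively_presented G) (memP : decidable_membership P).

Let xG := marking_value muG.
Let xH n : G := val (marking_value muH n).

Let xGC : computable_family xG.
Proof. exact: (marking_value_computable muG idfun). Qed.

Let xHC : computable_family xH.
Proof. exact: (marking_value_computable muH (val : H -> G)). Qed.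

Lemma medvedev_le_free_extension (A : finType) (X : set (config H A)) :
  medvedev_le (stream (@numbering _ muH) @` pullback (@gens _ muH) X)
              (stream (@numbering _ muG) @` pullback (@gens _ muG) (free_extension X)).
Proof.
(* With an index of the identity as left factor, the search merely finds a word over the generators
   of [G] for an element of [H]. *)
have [n1 n1E] := marking_value_surj muG 1%g.
have [f [fC fE]] : exists f, computable f /\ forall n, (xG n1 * xG (f n))%g = xH n.
  apply: (word_problem_search (a := fun=> n1)) => //; first exact: computable_const.
  move=> n; have [l <-] := marking_value_surj muG (xH n).
  by exists l; rewrite /xG n1E mul1g.
apply: (medvedev_le_stream fC) => _ [y Xy <-].
exists (fun w => coset_restriction 1%g y (word_value (@gens _ muH) (val w))).
  by exists (coset_restriction 1%g y).
move=> n; rewrite /coset_restriction mul1g; congr y.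
by have := fE n; rewrite /xG n1E mul1g => fnE; apply: esym; exact: fnE.
Qed.

Lemma free_extension_medvedev_le (A : finType) (X : set (config H A)) :
  (forall h x, X x -> X (shift h x)) ->
  medvedev_le (stream (@numbering _ muG) @` pullback (@gens _ muG) (free_extension X))
              (stream (@numbering _ muH) @` pullback (@gens _ muH) X).
Proof.
move=> XS; have [chi [chiC chiE]] := decidable_coset memP xGC xGC.
have PE (g : G) : P g -> exists h : H, val h = g.
  by move=> Pg; exists (Sub g Pg); rewrite SubK.
have P1 : P 1%g by rewrite -(gmulf1 (s := val : H -> G)); apply: valP.
(* [r n] is the least index of an element in the left coset of [xG n]. *)
have [||r [rC r0 rmin]] := @computable_search _ (fun n => [:: n])
  (fun n m => 1 - chi m n).
- apply: (computable_app2 computable_sub); first exact: computable_const.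
  by apply: (computable_app2 chiC); variable.
- by move=> n; exists n; rewrite chiE mulVg P1.
have chir n : chi (r n) n by have := r0 n; case: (chi _ _).
(* Indices naming elements of one coset have the same candidates, hence the same least one. *)
have rE m n : P ((xG m)^-1 * xG n)%g -> r m = r n.
  move=> /PE[h hE]; have chimn k : chi k m = chi k n.
    by rewrite !chiE -(mulVKg (xG m) (xG n)) -hE mulgA mem_mulr.
  by case: (ltngtP (r m) (r n)) => // /rmin; rewrite -?chimn ?chir // chimn chir.
(* [idx] is an arbitrary choice of indices; it turns [r] into a transversal on [G] and does not
   enter the reduction. *)
have /choice [idx idxE] : forall g, exists n, xG n = g by exact: marking_value_surj.
have tE : coset_transversal H (fun g => xG (r (idx g))).
  move=> g; split; first by rewrite -{2}[g]idxE -chiE chir.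
  by move=> h; congr (xG _); symmetry; apply: rE; rewrite !idxE mulKg; apply: valP.
have [f [fC fE]] : exists f, computable f /\ forall n, (xG (r n) * xH (f n))%g = xG n.
  apply: word_problem_search => // n; have := chir n; rewrite chiE => /PE[h hE].
  have [l lE] := marking_value_surj muH h; exists l.
  by rewrite /xH lE hE mulVKg.
apply: (medvedev_le_stream fC) => _ [x Xx <-].
exists (fun w => coset_glue tE (fun=> x) (word_value (@gens _ muG) (val w))).
  by exists (coset_glue tE (fun=> x)) => //; apply: free_extension_coset_glue.
move=> n; rewrite /coset_glue -/(marking_value muG n) -/(xG n); congr x.
(* [idx (xG n)] may differ from [n], but both name the same element, so [r] agrees on them. *)
apply: val_inj; rewrite SubK (_ : r _ = r n); last by apply: rE; rewrite idxE mulVg.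
by rewrite -[in LHS](fE n) mulKg.
Qed.

Lemma subshift_degree_free_extension (A : finType) (X : set (config H A)) :
  (forall h x, X x -> X (shift h x)) ->
  subshift_degree muG (free_extension X) = subshift_degree muH X.
Proof.
move=> XS; apply: eq_medvedev_degree; first exact: free_extension_medvedev_le.
exact: medvedev_le_free_extension.
Qed.

End Degrees.

Theorem corollary4p5 (G : groupType) (P : pred G) (H : subGroupType P)
    (muG : marking G) (muH : marking H) :
  recursively_presented G ->
  recursively_presented H ->
  decidable_membership P ->
  degrees_sft muH `<=` degrees_sft muG /\
  degrees_sofic muH `<=` degrees_sofic muG.
Proof.
move=> Grp _ memP.
have [t tE] := exists_coset_transversal H.
(* Copying one point of [X] onto every coset gives a point of the extension. *)
have nonempty (A : finType) (X : set (config H A)) :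
    (forall h x, X x -> X (shift h x)) -> X !=set0 -> free_extension X !=set0.
  move=> XS [x Xx]; exists (coset_glue tE (fun=> x)).
  by apply: free_extension_coset_glue.
split=> d [A [X [Xsft X0 ->]]]; exists A, (free_extension X).
  have XS h x : X x -> X (shift h x) by apply: sft_shift.
  by split; [exact: sft_free_extension | exact: nonempty
            | exact/esym/subshift_degree_free_extension].
have [[_ XS] _] := Xsft.
by split; [exact: sofic_free_extension | exact: nonempty
          | exact/esym/subshift_degree_free_extension].
Qed.
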